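(* Let $k\in\{1,2,3\}$. There do not exist smooth vector fields $C$ and $L_n$ ($n\in\mathbb{Z}$) on $\mathbb{R}^k$ with $C$ not identically zero satisfying the Virasoro relations \[ [L_m,L_n]=(m-n)L_{m+n}+\tfrac{1}{12}m(m^2-1)\delta_{m,-n}C,\qquad [L_m,C]=0,\qquad m,n\in\mathbb{Z}. \] That is, there are no realizations of the Virasoro algebra with nonzero central element by vector fields on $\mathbb{R}^k$, $k\le 3$.
   Context: The commutator of vector fields is $[Q,P]=QP-PQ$; $\delta_{a,b}$ is the Kronecker delta. Vector fields on $\mathbb{R}^3$ are first-order operators $\tau\partial_t+\xi\partial_x+\eta\partial_u$ with smooth coefficients in $(t,x,u)$ (analogously with fewer variables for $k<3$). *)

(* Defs.v *)
From HB Require Import structures.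
From mathcomp Require Import all_boot all_order all_algebra.
From mathcomp Require Import all_classical all_reals all_analysis.
Set Implicit Arguments. Unset Strict Implicit. Unset Printing Implicit Defensive.
Import Order.TTheory GRing.Theory Num.Theory.
Import numFieldNormedType.Exports.
Local Open Scope ring_scope.

Definition pder (R : realType) (k : nat) (j : 'I_k) (f : 'rV[R]_k -> R)
  : 'rV[R]_k -> R :=
  fun x => derive f x (delta_mx 0 j).

Definition ipder (R : realType) (k : nat) (js : seq 'I_k) (f : 'rV[R]_k -> R)
  : 'rV[R]_k -> R :=
  foldr (fun j g => pder j g) f js.

Definition smooth (R : realType) (k : nat) (f : 'rV[R]_k -> R) : Prop :=
  forall (js : seq 'I_k) (x : 'rV[R]_k), differentiable (ipder js f) x.

(* A vector field sum_j X_j d/dx_j on R^k, given by its coefficient functions. *)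
Definition vfield (R : realType) (k : nat) := 'I_k -> 'rV[R]_k -> R.

Definition smooth_vf (R : realType) (k : nat) (X : vfield R k) : Prop :=
  forall i, smooth (X i).

Definition vf_apply (R : realType) (k : nat) (X : vfield R k)
  (f : 'rV[R]_k -> R) : 'rV[R]_k -> R :=
  fun x => \sum_(j < k) X j x * pder j f x.

Definition vf_bracket (R : realType) (k : nat) (Q P : vfield R k) : vfield R k :=
  fun i x => vf_apply Q (P i) x - vf_apply P (Q i) x.

Definition vf_add (R : realType) (k : nat) (X Y : vfield R k) : vfield R k :=
  fun i x => X i x + Y i x.

Definition vf_scale (R : realType) (k : nat) (c : R) (X : vfield R k) : vfield R k :=
  fun i x => c * X i x.

Definition vf_zero (R : realType) (k : nat) : vfield R k := fun _ _ => 0.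

Definition virasoro_rel (R : realType) (k : nat) (L : int -> vfield R k)
  (C : vfield R k) : Prop :=
  (forall m n : int,
     vf_bracket (L m) (L n) =
     vf_add (vf_scale (m - n)%:~R (L (m + n)%R))
            (vf_scale ((m * (m ^+ 2 - 1))%:~R / 12%:R *
                       (if m == - n then 1 else 0)) C)) /\
  (forall m : int, vf_bracket (L m) C = @vf_zero R k).

(* Main.v *)
(** Write [E_j] for [L_(1-j)], so that modulo the centre [E_j] behaves like
    [x^j d/dx].  Fix a point [p] and a coordinate [i0] with [C i0 p != 0].  If a
    polynomial [f] is such that [F = \sum_i f_i E_i] vanishes at [p] together
    with the gradient of its [i0]-th coefficient, then the [i0]-th
    coefficient of the bracket of [F] with every [E_j] vanishes at [p].  Such [f] exist with
    two different degrees [a, b >= 2], since they are cut out by finitely many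
    linear equations.  Given two of them, [f] and [g], bracket [f] with [f q]
    where [q' = g^2 x^(1-2a-2b)]; the Witt part of the bracket is
    [f^2 g^2 x^(1-2a-2b)], symmetric in [f] and [g], whereas the central part is
    a nonzero multiple, symmetric in [f] and [g], of [a (a - 2)].  Exchanging [f] and [g] yields
    [a (a - 2) = b (b - 2)], which is absurd. *)
Require Import Defs.
From HB Require Import structures.
From mathcomp Require Import all_boot all_order all_algebra.
From mathcomp Require Import all_classical all_reals all_analysis.
From mathcomp Require Import zify ring lra.
Set Implicit Arguments.
Unset Strict Implicit.
Import Order.TTheory GRing.Theory Num.Theory.
Local Open Scope ring_scope.

(** The functional [x^j |-> psi j] on Laurent polynomials, applied to [x^z p]; the shift [z]
    supplies the negative powers. *)
Definition laurent_eval (R : realType) (psi : int -> R) (z : int) (p : {poly R}) : R :=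
  \sum_(i < size p) p`_i * psi (i%:Z + z).

Lemma laurent_eval_widen (R : realType) (psi : int -> R) z (p : {poly R}) n :
  (size p <= n)%N ->
  laurent_eval psi z p = \sum_(i < n) p`_i * psi (i%:Z + z).
Proof.
move=> le_pn; rewrite /laurent_eval (big_ord_widen n (fun i => p`_i * psi (i%:Z + z))) //.
rewrite big_mkcond; apply: eq_bigr => i _.
by case: ltnP => // /(nth_default 0) ->; rewrite mul0r.
Qed.

Lemma laurent_eval_is_linear (R : realType) (psi : int -> R) z :
  linear_for *%R (laurent_eval psi z).
Proof.
move=> a p q; pose n := maxn (size (a *: p + q)) (maxn (size p) (size q)).
rewrite !(@laurent_eval_widen _ psi z _ n) ?leq_max ?leqnn ?orbT //.
rewrite mulr_sumr -big_split /=; apply: eq_bigr => i _.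
by rewrite coefD coefZ mulrDl mulrA.
Qed.

HB.instance Definition _ (R : realType) (psi : int -> R) z :=
  GRing.isLinear.Build R {poly R} R *%R (laurent_eval psi z)
    (@laurent_eval_is_linear R psi z).

Lemma laurent_evalXn (R : realType) (psi : int -> R) z n :
  laurent_eval psi z 'X^n = psi (n%:Z + z).
Proof.
rewrite /laurent_eval size_polyXn big_ord_recr /= coefXn eqxx mul1r big1 ?add0r //.
by move=> i _; rewrite coefXn ltn_eqF // mul0r.
Qed.

(** This is [x^3 f''']. *)
Definition cube_euler (R : realType) (f : {poly R}) : {poly R} :=
  \poly_(i < size f) (i%:R * (i%:R - 1) * (i%:R - 2) * f`_i).

(** The functional [x^j d/dx |-> psi j], with central charge [c], annihilates the
    Virasoro brackets of [f d/dx] with all [x^j d/dx]. *)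
Definition annihilates (R : realType) (psi : int -> R) (c : R) (f : {poly R}) : Prop :=
  forall j : int,
    \sum_(i < size f) f`_i * ((j%:~R - i%:R) * psi (i%:Z + j - 1)) =
    \sum_(i < size f) f`_i *
      (i%:R * (i%:R - 1) * (i%:R - 2) * (i%:Z + j == 2)%:R * c).

(** Here [f d/dx] is bracketed with [x^z h d/dx], the factor [x^(z-1)] being taken out of the Witt
    part. The central part is the residue of [f''' x^z h], hence the condition on [N]. *)
Lemma annihilates_poly (R : realType) (psi : int -> R) c (f h : {poly R}) (z : int) N :
  annihilates psi c f -> N%:Z + z = 2 ->
  laurent_eval psi (z - 1) (f * ('X * h^`() + z%:~R *: h) - 'X * f^`() * h) =
  c * (cube_euler f * h)`_N.
Proof.
(* Both sides are linear in [h], so monomials [x^j] suffice; there [ann] applies at index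
   [j + z]. *)
move=> ann Nz; rewrite -[h]coefK poly_def.
rewrite linear_sum !mulr_sumr /= scaler_sumr -big_split /= !mulr_sumr -sumrB.
rewrite coef_sum linear_sum mulr_sumr; apply: eq_bigr => -[j /= _] _.
have -> : f * ('X * (h`_j *: 'X^j)^`() + z%:~R *: (h`_j *: 'X^j))
    - 'X * f^`() * (h`_j *: 'X^j) =
  h`_j *: \sum_(i < size f) (f`_i * ((j%:Z + z)%:~R - i%:R)) *: 'X^(i + j).
  have Xd n : 'X * ('X^n)^`() = n%:R%:P * 'X^n :> {poly R}.
    rewrite derivXn mulrnAr mul_polyC scaler_nat.
    by case: n => [|n]; rewrite ?mulr0n //= -exprS.
  have alg (x xi xj di dj F H Z I J : {poly R}) :
      x * di = I * xi -> x * dj = J * xj ->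
      F * xi * (x * (H * dj) + Z * (H * xj)) - x * (F * di) * (H * xj) =
      H * (F * (J + Z - I) * (xi * xj)).
    move=> Ei Ej.
    transitivity (F * xi * (H * (x * dj) + Z * H * xj) - F * (x * di) * H * xj).
      by ring.
    by rewrite Ei Ej; ring.
  rewrite derivZ -[in LHS](coefK f) poly_def linear_sum /= mulr_suml mulr_sumr.
  rewrite mulr_suml -sumrB scaler_sumr; apply: eq_bigr => i _.
  rewrite derivZ exprD rmorphD /= -!mul_polyC polyCM polyCB polyCD.
  exact: alg (Xd i) (Xd j).
rewrite linearZ -scalerAr coefZ [RHS]mulrCA /= linear_sum /=; congr (_ * _).
transitivity (\sum_(i < size f) f`_i *
    (((j%:Z + z)%:~R - i%:R) * psi (i%:Z + (j%:Z + z) - 1))).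
  apply: eq_bigr => i _; rewrite linearZ /= laurent_evalXn -mulrA.
  by congr (_ * (_ * psi _)); lia.
(* As [N + z = 2], the Kronecker symbol selects [i = N - j], if that is an index of [f]. *)
rewrite ann coefMXn; case: ltnP => [lt_Nj|le_jN].
  by rewrite mulr0 big1 // => i _; rewrite (_ : _ == _ = false) ?mulr0 ?mul0r ?mulr0 //; lia.
rewrite coef_poly; case: ltnP => [lt_f|le_f].
  rewrite (bigD1 (Ordinal lt_f)) //= big1 ?addr0 => [|i ne_i].
    by rewrite (_ : _ == _ = true) ?mulr1; [ring | lia].
  rewrite (_ : _ == _ = false) ?mulr0 ?mul0r ?mulr0 //.
  by move: ne_i; rewrite -val_eqE /=; lia.
rewrite mulr0 big1 // => i _; rewrite (_ : _ == _ = false) ?mulr0 ?mul0r ?mulr0 //.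
by have := ltn_ord i; lia.
Qed.

Lemma coefM_top (R : realType) (p q : {poly R}) a b :
  (size p <= a.+1)%N -> (size q <= b.+1)%N -> (p * q)`_(a + b) = p`_a * q`_b.
Proof.
move=> pa qb; rewrite coefM (bigD1 (Ordinal (leq_addr b a : a < (a + b).+1)%N)) //=.
rewrite addKn big1 ?addr0 // => i ne_ia.
have [lt_ia|le_ai] := ltnP i a.
  by rewrite [q`__]nth_default ?mulr0 //; apply: leq_trans qb _; lia.
rewrite nth_default ?mul0r //; apply: leq_trans pa _.
by rewrite ltn_neqAle le_ai eq_sym andbT -val_eqE in ne_ia *.
Qed.

(** [x^z r] is a primitive of [x^(z-1) p]; the hypothesis rules out a term in [x^(-1)], which would
    integrate to a logarithm. *)
Lemma euler_ode_solution (R : realType) (p : {poly R}) (z : int) :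
  (forall i, (i < size p)%N -> i%:Z + z != 0) ->
  {r : {poly R} | 'X * r^`() + z%:~R *: r = p
                & forall i, r`_i = p`_i / (i%:Z + z)%:~R}.
Proof.
move=> nz; pose r : {poly R} := \poly_(i < size p) (p`_i / (i%:Z + z)%:~R).
have coefr i : r`_i = p`_i / (i%:Z + z)%:~R.
  by rewrite coef_poly; case: ltnP => // /(nth_default 0) ->; rewrite mul0r.
exists r => //; apply/polyP=> i.
have -> : ('X * r^`() + z%:~R *: r)`_i = i%:R * r`_i + z%:~R * r`_i.
  rewrite coefD coefZ coefXM coef_deriv; congr (_ + _).
  by case: i => [|i] /=; rewrite ?mul0r // mulr_natl.
rewrite coefr -mulrDl.
have [lt_ip|/(nth_default 0) ->] := ltnP i (size p); last by rewrite mul0r mulr0.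
rewrite mulrC -mulrA [X in _ * X](_ : _ = 1) ?mulr1 //.
rewrite [X in _ * X](_ : _ = (i%:Z + z)%:~R) ?mulVf ?intr_eq0 ?nz //.
by rewrite rmorphD.
Qed.

(** The instance [h = f r] of [annihilates_poly], where [x^(2-2a-2b) r] is the
    primitive of [g^2 x^(1-2a-2b)]. *)
Lemma annihilates_sqr_mul_sqr (R : realType) (psi : int -> R) c (f g : {poly R}) a b :
  (1 < a)%N -> size f = a.+1 -> size g = b.+1 -> annihilates psi c f ->
  laurent_eval psi (1 - (2 * a + 2 * b)%:Z) (f ^+ 2 * g ^+ 2) =
  - (c * (a%:R * (a%:R - 2)) / 2 * (lead_coef f * lead_coef g) ^+ 2).
Proof.
move=> a1 sf sg ann; pose N := (2 * a + 2 * b)%N; pose z : int := 2 - N%:Z.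
have sg2 : (size (g ^+ 2) <= (b + b).+1)%N.
  by apply: leq_trans (size_polyMleq _ _) _; rewrite sg; lia.
have [|r rE coefr] := @euler_ode_solution R (g ^+ 2) z.
  by move=> i ig; have := leq_trans ig sg2; rewrite /z /N; lia.
have sr : (size r <= (b + b).+1)%N.
  apply/leq_sizeP => i bi; rewrite coefr nth_default ?mul0r //.
  exact: leq_trans sg2 bi.
have sfr : (size (f * r)%R <= (a + (b + b)).+1)%N.
  by apply: leq_trans (size_polyMleq _ _) _; rewrite sf; lia.
have st : (size (cube_euler f) <= a.+1)%N by rewrite -sf size_poly.
have := annihilates_poly (f * r) ann (subrKC N%:Z 2); rewrite -/z.
have -> : f * ('X * (f * r)^`() + z%:~R *: (f * r)) - 'X * f^`() * (f * r) =
    f ^+ 2 * g ^+ 2.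
  by rewrite -rE derivM -!mul_polyC; ring.
have -> : z - 1 = 1 - (2 * a + 2 * b)%:Z by rewrite /z /N; lia.
move=> ->; have -> : N = (a + (a + (b + b)))%N by rewrite /N; lia.
(* [N] bounds the degree of [cube_euler f * (f * r)], so only top coefficients enter; that of [r]
   carries the denominator [2 - 2a], which cancels the factor [a - 1]. *)
rewrite !coefM_top ?sf // coefr expr2 coefM_top ?sg // coef_poly sf ltnSn.
rewrite /lead_coef sf sg /=.
have -> : ((b + b)%:Z + z)%:~R = 2 - 2 * a%:R :> R.
  have -> : (b + b)%:Z + z = 2 - (2 * a)%:Z by rewrite /z /N; lia.
  by rewrite rmorphB /= -!pmulrn natrM.
have : a%:R > 1 :> R by rewrite ltr1n.
move: (a%:R : R) (f`_a) (g`_b) => x lf lg x1.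
have nz : 2 - 2 * x != 0 by apply/eqP; move: x1; clear; lra.
by field.
Qed.

Lemma annihilates_degree_inj (R : realType) (psi : int -> R) c (f g : {poly R}) a b :
  c != 0 -> (1 < a)%N -> (1 < b)%N -> size f = a.+1 -> size g = b.+1 ->
  annihilates psi c f -> annihilates psi c g -> a = b.
Proof.
move=> c0 a1 b1 sf sg annf anng.
have := annihilates_sqr_mul_sqr a1 sf sg annf.
rewrite mulrC addnC (annihilates_sqr_mul_sqr b1 sg sf anng).
move/eqP; rewrite eqr_opp [lead_coef g * _]mulrC => /eqP/mulIf.
have lfg : lead_coef f * lead_coef g != 0.
  by rewrite mulf_neq0 // lead_coef_eq0 -size_poly_gt0 ?sf ?sg.
move=> /(_ (expf_neq0 _ lfg))/mulIf; rewrite invr_neq0 ?pnatr_eq0 // => /(_ isT).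
move=> /(mulfI c0) E.
have a1R : a%:R > 1 :> R by rewrite ltr1n.
have b1R : b%:R > 1 :> R by rewrite ltr1n.
(* The equation factors as [(a - b)(a + b - 2) = 0], and [a + b > 2]. *)
apply/eqP; rewrite -(eqr_nat R); apply/eqP; nra.
Qed.

(** The [n + 1] vectors [v d, ..., v (d + n)] are dependent in dimension [n]; starting at [d] forces
    the degree up. *)
Lemma exists_poly_kernel (R : realType) n (v : nat -> 'rV[R]_n) d :
  exists2 f : {poly R}, (d < size f)%N & \sum_(i < size f) f`_i *: v i = 0.
Proof.
pose M : 'M[R]_(n.+1, n) := \matrix_(i < n.+1) v (i + d)%N.
have : kermx M != 0.
  rewrite -mxrank_eq0 mxrank_ker subn_eq0 -ltnNge ltnS; exact: rank_leq_col.
case/rowV0Pn => u /sub_kermxP uM u0.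
have p0 : rVpoly u != 0 by rewrite -(raddf0 (@rVpoly R n.+1)) (can_eq rVpolyK).
exists (rVpoly u * 'X^d); first by rewrite size_mulXn // -addn1 leq_add2l size_poly_gt0.
have le_size : (size (rVpoly u * 'X^d)%R <= d + n.+1)%N.
  by rewrite size_mulXn // leq_add2l size_poly.
rewrite (big_ord_widen _ (fun i => (rVpoly u * 'X^d)`_i *: v i) le_size) big_mkcond /=.
rewrite (eq_bigr (fun i : 'I__ => (rVpoly u * 'X^d)`_i *: v i)) => [|i _]; last first.
  by case: ltnP => // /(nth_default 0) ->; rewrite scale0r.
rewrite big_split_ord /= big1 ?add0r => [|i _]; last first.
  by rewrite coefMXn ltn_ord scale0r.
rewrite -[RHS]uM mulmx_sum_row; apply: eq_bigr => i _.
by rewrite rowK coefMXn ltnNge leq_addr /= addKn coef_rVpoly_ord addnC.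
Qed.

Theorem theorem4 (R : realType) (k : nat) (hk1 : (1 <= k)%N) (hk3 : (k <= 3)%N) :
  ~ exists (L : int -> vfield R k) (C : vfield R k),
      (forall n : int, smooth_vf (L n)) /\ smooth_vf C /\
      (exists (i : 'I_k) (x : 'rV[R]_k), C i x != 0) /\
      virasoro_rel L C.
Proof.
case=> L [C [_ [_ [[i0 [p Cp]] [rel _]]]]].
pose E (j : int) := L (1 - j).
pose v (j : nat) : 'rV[R]_(k + k) :=
  row_mx (\row_l E j%:Z l p) (\row_l pder l (E j%:Z i0) p).
have ann (f : {poly R}) : \sum_(i < size f) f`_i *: v i = 0 ->
    annihilates (fun j => E j i0 p) (C i0 p / 12%:R) f.
  move=> fv j.
  have val0 l : \sum_(i < size f) f`_i * E (i : nat)%:Z l p = 0.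
    have := congr1 (fun w : 'rV[R]_(k + k) => w 0 (lshift k l)) fv.
    rewrite summxE mxE => fvl; rewrite -[RHS]fvl; apply: eq_bigr => i _.
    by rewrite mxE row_mxEl mxE.
  have der0 l : \sum_(i < size f) f`_i * pder l (E (i : nat)%:Z i0) p = 0.
    have := congr1 (fun w : 'rV[R]_(k + k) => w 0 (rshift k l)) fv.
    rewrite summxE mxE => fvl; rewrite -[RHS]fvl; apply: eq_bigr => i _.
    by rewrite mxE row_mxEr mxE.
  (* At [p] this coefficient involves [F] only through its values and the gradient of its [i0]-th
     coefficient. *)
  have br0 : \sum_(i < size f) f`_i * vf_bracket (E (i : nat)%:Z) (E j) i0 p = 0.
    rewrite /vf_bracket /vf_apply.
    under eq_bigr => i _ do rewrite mulrBr !mulr_sumr.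
    rewrite sumrB exchange_big /= [X in _ - X]exchange_big /= !big1 ?subr0 // => l _.
      under eq_bigr => i _ do rewrite mulrCA.
      by rewrite -mulr_sumr der0 mulr0.
    under eq_bigr => i _ do rewrite mulrA.
    by rewrite -mulr_suml val0 mul0r.
  apply/eqP; rewrite -subr_eq0 -sumrB -[X in _ == X]br0; apply/eqP/eq_bigr => i _.
  rewrite -mulrBr; congr (_ * _).
  (* With [m = 1 - i], [m (m^2 - 1) = - i (i - 1) (i - 2)], so the central charge is
     [C i0 p / 12]. *)
  rewrite /E rel /vf_add /vf_scale.
  have -> : (1 - (i : nat)%:Z == - (1 - j)) = ((i : nat)%:Z + j == 2) by lia.
  have -> : 1 - (i : nat)%:Z + (1 - j) = 1 - ((i : nat)%:Z + j - 1) by lia.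
  rewrite !(rmorphD, rmorphN, rmorphM, rmorphXn) /=.
  by case: eqP => _ /=; field.
have c0 : C i0 p / 12%:R != 0 by rewrite mulf_neq0 ?invr_neq0 ?pnatr_eq0.
(* Size above 2 means degree at least 2; asking [g] to be longer than [f] makes the degrees
   differ. *)
have [f sf fv] := exists_poly_kernel v 2.
have [g sg gv] := exists_poly_kernel v (size f).
have sfE : size f = (size f).-1.+1 by rewrite prednK // (ltn_trans _ sf).
have sgE : size g = (size g).-1.+1 by rewrite prednK // (leq_ltn_trans _ sg).
have := annihilates_degree_inj c0 _ _ sfE sgE (ann f fv) (ann g gv).
by move=> H; have := H _ _; lia.
Qed.
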